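(* Let $A$ be a symmetric and invertible three-level sparse matrix with blocks $A_{11}$, $A_{12,i}$, $A_{22,i}$ ($1\le i\le m$) and $A_{12,ij}$, $A_{12,\,i,\,j}$, $A_{22,ij}$ ($1\le i\le m$, $1\le j\le n_i$), as specified in the context, and let $a$ be a vector partitioned conformably with $A$ into $a_1$, $a_{2,i}$ and $a_{2,ij}$. Suppose that all $A_{22,ij}$, $1\le i\le m$, $1\le j\le n_i$, are invertible. For $1\le i\le m$, define $$h_{2,i}=a_{2,i}-\sum_{j=1}^{n_i}A_{12,\,i,\,j}\,A_{22,ij}^{-1}\,a_{2,ij},\qquad H_{12,i}=A_{12,i}-\sum_{j=1}^{n_i}A_{12,ij}\,A_{22,ij}^{-1}\,A_{12,\,i,\,j}^T,$$ $$H_{22,i}=A_{22,i}-\sum_{j=1}^{n_i}A_{12,\,i,\,j}\,A_{22,ij}^{-1}\,A_{12,\,i,\,j}^T,$$ and suppose that all $H_{22,i}$, $1\le i\le m$, are invertible. Then the following hold. (Inverse sub-blocks) $$A^{11}=\left(A_{11}-\sum_{i=1}^m\sum_{j=1}^{n_i}A_{12,ij}\,A_{22,ij}^{-1}\,A_{12,ij}^T-\sum_{i=1}^m H_{12,i}\,H_{22,i}^{-1}\,H_{12,i}^T\right)^{-1};$$ for $1\le i\le m$, $$A^{12,i}=-\left(H_{22,i}^{-1}\,H_{12,i}^T\,A^{11}\right)^T,\qquad A^{22,i}=H_{22,i}^{-1}\left(I-H_{12,i}^T\,A^{12,i}\right);$$ and, for $1\le i\le m$, $1\le j\le n_i$,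 $$A^{12,ij}=-\left\{A_{22,ij}^{-1}\left(A_{12,ij}^T\,A^{11}+A_{12,\,i,\,j}^T\,(A^{12,i})^T\right)\right\}^T,$$ $$A^{12,\,i,\,j}=-\left\{A_{22,ij}^{-1}\left(A_{12,ij}^T\,A^{12,i}+A_{12,\,i,\,j}^T\,A^{22,i}\right)\right\}^T,$$ $$A^{22,ij}=A_{22,ij}^{-1}\left(I-A_{12,ij}^T\,A^{12,ij}-A_{12,\,i,\,j}^T\,A^{12,\,i,\,j}\right).$$ (Determinant) $$|A|=\left|\left(A^{11}\right)^{-1}\right|\,\prod_{i=1}^m\left(\left|A_{22,i}-\sum_{j=1}^{n_i}A_{12,\,i,\,j}\,A_{22,ij}^{-1}\,A_{12,\,i,\,j}^T\right|\prod_{j=1}^{n_i}\left|A_{22,ij}\right|\right).$$ (Linear system) The solution $x$ of $Ax=a$, partitioned conformably into $x_1$, $x_{2,i}$, $x_{2,ij}$, is $$x_1=A^{11}\left(a_1-\sum_{i=1}^m H_{12,i}\,H_{22,i}^{-1}\,h_{2,i}-\sum_{i=1}^m\sum_{j=1}^{n_i}A_{12,ij}\,A_{22,ij}^{-1}\,a_{2,ij}\right),$$ $$x_{2,i}=H_{22,i}^{-1}\left(h_{2,i}-H_{12,i}^T\,x_1\right),\quad 1\le i\le m,$$ $$x_{2,ij}=A_{22,ij}^{-1}\left(a_{2,ij}-A_{12,ij}^T\,x_1-A_{12,\,i,\,j}^T\,x_{2,i}\right),\quad 1\le i\le m,\ 1\le j\le n_i.$$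
   Context: All matrices and vectors are real; $m,p,q_1,q_2,n_1,\ldots,n_m$ are positive integers. $O$ is a zero matrix, $I$ an identity matrix of appropriate size, $|M|$ the determinant of a square matrix $M$, and $\mathrm{blockdiag}$ denotes the block diagonal matrix with the listed blocks. Three-level sparse matrix: $A=\begin{bmatrix}A_{11}&A_{12}\\ A_{12}^T&A_{22}\end{bmatrix}$ is symmetric and invertible, where $A_{11}$ is $p\times p$, $$A_{12}=\big[\,A_{12,1}\,|\,A_{12,11}\,|\cdots|\,A_{12,1n_1}\,|\,A_{12,2}\,|\,A_{12,21}\,|\cdots|\,A_{12,2n_2}\,|\cdots|\,A_{12,m}\,|\,A_{12,m1}\,|\cdots|\,A_{12,mn_m}\,\big],$$ i.e. $A_{12}$ is the horizontal concatenation over $i=1,\ldots,m$ of $[A_{12,i}\,|\,A_{12,i1}\,|\cdots|\,A_{12,in_i}]$, with $A_{12,i}$ being $p\times q_1$ and $A_{12,ij}$ being $p\times q_2$; and $$A_{22}=\mathrm{blockdiag}_{1\le i\le m}\begin{bmatrix}A_{22,i}&A_{12,\,i,\,1}&A_{12,\,i,\,2}&\cdots&A_{12,\,i,\,n_i}\\ A_{12,\,i,\,1}^T&A_{22,i1}&O&\cdots&O\\ A_{12,\,i,\,2}^T&O&A_{22,i2}&\cdots&O\\ \vdots&\vdots&\vdots&\ddots&\vdots\\ A_{12,\,i,\,n_i}^T&O&O&\cdots&A_{22,in_i}\end{bmatrix},$$ where $A_{22,i}$ is $q_1\times q_1$, $A_{12,\,i,\,j}$ is $q_1\times q_2$ and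 $A_{22,ij}$ is $q_2\times q_2$. Note that $A_{12,ij}$ (no comma between $i$ and $j$; a $p\times q_2$ block of $A_{12}$) and $A_{12,\,i,\,j}$ (with a comma; a $q_1\times q_2$ block of $A_{22}$) are different matrices. The inverse $A^{-1}$ is partitioned in the same way as $A$, and $A^{11}$, $A^{12,i}$, $A^{22,i}$, $A^{12,ij}$, $A^{12,\,i,\,j}$, $A^{22,ij}$ denote the blocks of $A^{-1}$ in the positions of $A_{11}$, $A_{12,i}$, $A_{22,i}$, $A_{12,ij}$, $A_{12,\,i,\,j}$, $A_{22,ij}$, respectively (superscripts are block labels, not powers). Vectors are partitioned conformably: $a$ is the vertical concatenation of $a_1$ ($p\times1$) followed, for $i=1,\ldots,m$ in order, by $a_{2,i}$ ($q_1\times1$), $a_{2,i1},\ldots,a_{2,in_i}$ (each $q_2\times1$); $x$ is partitioned in the same way into $x_1$, $x_{2,i}$, $x_{2,ij}$. *)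

(* Defs.v *)
From mathcomp Require Import all_boot all_order all_algebra.
From mathcomp Require Import reals.

Set Implicit Arguments.
Unset Strict Implicit.
Unset Printing Implicit Defensive.

Import GRing.Theory.
Local Open Scope ring_scope.

(* [dim2 q1 q2 k] is the size of one group, i.e. a
   q1-block followed by k blocks of size q2; [dim3] is the total size of the m
   groups, the i-th one having [n i] blocks of size q2. *)
Notation dim2 q1 q2 k := (q1 + \sum_(j < k) q2)%N.
Notation dim3 q1 q2 n := (\sum_i dim2 q1 q2 (n i))%N.

Section ThreeLevel.
Variables (R : realType) (m p q1 q2 : nat) (n : 'I_m -> nat).

(* Naming: an underscore in [_i_j] stands for the comma: [A12ij i j] is the
   p x q2 block A_{12,ij}, whereas [A12i_j i j] is the q1 x q2 block
   A_{12,i,j} of A_22. *)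
Definition three_level_mx
    (A11 : 'M[R]_p)
    (A12i : 'I_m -> 'M[R]_(p, q1))
    (A12ij : forall i, 'I_(n i) -> 'M[R]_(p, q2))
    (A22i : 'I_m -> 'M[R]_q1)
    (A12i_j : forall i, 'I_(n i) -> 'M[R]_(q1, q2))
    (A22ij : forall i, 'I_(n i) -> 'M[R]_q2) : 'M[R]_(p + dim3 q1 q2 n) :=
  let A12 : 'M_(p, dim3 q1 q2 n) :=
    \mxrow_(i < m) row_mx (A12i i) (\mxrow_(j < n i) A12ij i j) in
  let A22 : 'M_(dim3 q1 q2 n) :=
    \mxdiag_(i < m)
      block_mx (A22i i)                       (\mxrow_(j < n i) A12i_j i j)
               (\mxcol_(j < n i) (A12i_j i j)^T) (\mxdiag_(j < n i) A22ij i j) in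
  block_mx A11 A12 A12^T A22.

Definition three_level_cV
    (a1 : 'cV[R]_p)
    (a2i : 'I_m -> 'cV[R]_q1)
    (a2ij : forall i, 'I_(n i) -> 'cV[R]_q2) : 'cV[R]_(p + dim3 q1 q2 n) :=
  col_mx a1 (\mxcol_(i < m) col_mx (a2i i) (\mxcol_(j < n i) a2ij i j)).

Section Blocks.
Variable B : 'M[R]_(p + dim3 q1 q2 n).

Definition blk11 : 'M[R]_p := ulsubmx B.

Definition blk12_group (i : 'I_m) : 'M[R]_(p, dim2 q1 q2 (n i)) :=
  submxrow (ursubmx B) i.

Definition blk22_group (i : 'I_m) : 'M[R]_(dim2 q1 q2 (n i)) :=
  submxblock (drsubmx B) i i.

Definition blk12i (i : 'I_m) : 'M[R]_(p, q1) := lsubmx (blk12_group i).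

Definition blk12ij (i : 'I_m) (j : 'I_(n i)) : 'M[R]_(p, q2) :=
  submxrow (rsubmx (blk12_group i)) j.

Definition blk22i (i : 'I_m) : 'M[R]_q1 := ulsubmx (blk22_group i).

Definition blk12i_j (i : 'I_m) (j : 'I_(n i)) : 'M[R]_(q1, q2) :=
  submxrow (ursubmx (blk22_group i)) j.

Definition blk22ij (i : 'I_m) (j : 'I_(n i)) : 'M[R]_q2 :=
  submxblock (drsubmx (blk22_group i)) j j.

End Blocks.

Section SubVectors.
Variable x : 'cV[R]_(p + dim3 q1 q2 n).

Definition vec1 : 'cV[R]_p := usubmx x.

Definition vec2_group (i : 'I_m) : 'cV[R]_(dim2 q1 q2 (n i)) :=
  submxcol (dsubmx x) i.

Definition vec2i (i : 'I_m) : 'cV[R]_q1 := usubmx (vec2_group i).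

Definition vec2ij (i : 'I_m) (j : 'I_(n i)) : 'cV[R]_q2 :=
  submxcol (dsubmx (vec2_group i)) j.

End SubVectors.

Lemma three_level_mxK A11 A12i A12ij A22i A12i_j A22ij :
  let A := three_level_mx A11 A12i A12ij A22i A12i_j A22ij in
  [/\ blk11 A = A11,
      forall i, blk12i A i = A12i i /\ blk22i A i = A22i i
    & forall i j, [/\ blk12ij A j = A12ij i j,
                      blk12i_j A j = A12i_j i j
                    & blk22ij A j = A22ij i j]].
Proof.
move=> A; rewrite /blk12i /blk12ij /blk22i /blk12i_j /blk22ij.
rewrite /blk12_group /blk22_group /blk11 /A /three_level_mx.
rewrite block_mxKul block_mxKur block_mxKdr; split=> // [i|i j].
  by rewrite mxrowK row_mxKl submxblock_diag block_mxKul.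
rewrite mxrowK row_mxKr submxblock_diag block_mxKur block_mxKdr.
by rewrite !mxrowK submxblock_diag.
Qed.

Lemma three_level_cVK a1 a2i a2ij :
  let a := three_level_cV a1 a2i a2ij in
  [/\ vec1 a = a1, forall i, vec2i a i = a2i i
    & forall i j, vec2ij a j = a2ij i j].
Proof.
move=> a; rewrite /vec1 /vec2i /vec2ij /vec2_group /a /three_level_cV.
by rewrite col_mxKu col_mxKd; split=> // [i|i j]; rewrite mxcolK ?col_mxKu ?col_mxKd ?mxcolK.
Qed.

End ThreeLevel.

Arguments three_level_mx {R m p q1 q2 n}.
Arguments three_level_cV {R m p q1 q2 n}.
Arguments blk11 {R m p q1 q2 n}.
Arguments blk12i {R m p q1 q2 n}.
Arguments blk12ij {R m p q1 q2 n}.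
Arguments blk22i {R m p q1 q2 n}.
Arguments blk12i_j {R m p q1 q2 n}.
Arguments blk22ij {R m p q1 q2 n}.
Arguments vec1 {R m p q1 q2 n}.
Arguments vec2i {R m p q1 q2 n}.
Arguments vec2ij {R m p q1 q2 n}.

(* Main.v *)
Require Import Defs.
From mathcomp Require Import all_boot all_order all_algebra.
From mathcomp Require Import reals.
Import GRing.Theory.
Local Open Scope ring_scope.

Set Implicit Arguments.
Unset Strict Implicit.

(** A three-level sparse matrix is an arrowhead matrix: a dense border of
    height [p] along a block diagonal matrix, one block per group.  Each of
    those diagonal blocks is again an arrowhead matrix, with border of height
    [q1] and diagonal blocks [A22ij i j].  Everything follows from block
    elimination for arrowhead matrices, used once at each level.

    For [arrow_mx P U D], with border [U] and invertible diagonal blocks [D i],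
    eliminating the unknowns of the blocks leaves the Schur complement
    [arrow_schur P U D] acting on the border unknowns ([arrow_solve]), and its
    determinant multiplied by those of the [D i] is the determinant of the whole
    matrix ([det_arrow]).  Inside group [i] the Schur complement is H_{22,i}, so
    its invertibility makes the group invertible.  At the outer level the Schur
    complement and the reduced right-hand side contain products U D^-1 Y whose
    middle factor is the inverse of a group; [arrow_invmx_form] evaluates such a
    product by elimination in the group, and this is where H_{12,i} and h_{2,i}
    come from ([three_level_schur], [three_level_solve]).

    The right-hand side in [three_level_solve] may have any number of columns.
    One column gives the linear system.  The block columns of the identity
    give the block columns of the inverse of A; since that inverse is symmetric,
    the blocks below its diagonal are the transposes of the named ones
    ([rows_cols]), and the elimination equations become the formulas for the
    sub-blocks.  In the first block column the outer equation says that the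
    Schur complement times the leading block of the inverse is the identity,
    which yields both its invertibility and the formula for that block. *)

(** * Block diagonal and arrowhead matrices *)

Lemma oppmx_tr (V : zmodType) (k l : nat) (M : 'M[V]_(k, l)) (N : 'M[V]_(l, k)) :
  M^T = - N -> M = - N^T.
Proof. by move=> MN; rewrite -[M]trmxK MN raddfN. Qed.

Lemma det_mxdiag (R : comPzRingType) (k : nat) (q : 'I_k -> nat)
    (D : forall i, 'M[R]_(q i)) :
  \det (\mxdiag_i D i) = \prod_i \det (D i).
Proof.
elim: k q D => [|k IHk] q D.
  suff s0 : (\sum_(i < 0) q i = 0)%N.
    by move: (\mxdiag_i D i); rewrite s0 big_ord0 => M; rewrite det_mx00.
  by rewrite big_ord0.
rewrite mxdiag_recl [RHS]big_ord_recl -IHk -(det_ublock (D ord0) 0).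
by move: mxsize_recl (block_mx _ _ _ _) => e; case: _ / e => M; rewrite castmx_id.
Qed.

Definition arrow_mx (R : pzSemiRingType) (k p : nat) (q : 'I_k -> nat)
    (P : 'M[R]_p) (U : forall i, 'M[R]_(p, q i)) (D : forall i, 'M[R]_(q i)) :
    'M[R]_(p + \sum_i q i) :=
  block_mx P (\mxrow_i U i) (\mxrow_i U i)^T (\mxdiag_i D i).

Definition arrow_schur (R : comUnitRingType) (k p : nat) (q : 'I_k -> nat)
    (P : 'M[R]_p) (U : forall i, 'M[R]_(p, q i)) (D : forall i, 'M[R]_(q i)) :
    'M[R]_p :=
  P - \sum_i U i *m invmx (D i) *m (U i)^T.

Lemma arrow_mulmx (R : pzSemiRingType) (k p c : nat) (q : 'I_k -> nat)
    (P : 'M[R]_p) (U : forall i, 'M[R]_(p, q i)) (D : forall i, 'M[R]_(q i))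
    (X Y : 'M[R]_(p + \sum_i q i, c)) :
  arrow_mx P U D *m X = Y ->
  P *m usubmx X + \sum_i U i *m submxcol (dsubmx X) i = usubmx Y /\
  forall i, (U i)^T *m usubmx X + D i *m submxcol (dsubmx X) i =
            submxcol (dsubmx Y) i.
Proof.
move=> <-; rewrite -[X]vsubmxK -[dsubmx X]submxcolK /arrow_mx mul_block_col.
rewrite tr_mxrow !mul_mxrow_mxcol mul_mxdiag_mxcol mxcol_mul -mxcolD.
rewrite !col_mxKu !col_mxKd; split=> [|i]; last by rewrite !mxcolK.
by congr (_ + _); apply: eq_bigr => i _; rewrite mxcolK.
Qed.

(** The rows of block [i] express its unknowns through the border unknowns;
    substituting this in the border rows leaves the Schur complement.  The first
    equation is left unsolved because, at the outer level, the invertibility of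
    the Schur complement is itself deduced from it. *)
Lemma arrow_solve (R : comUnitRingType) (k p c : nat) (q : 'I_k -> nat)
    (P : 'M[R]_p) (U : forall i, 'M[R]_(p, q i)) (D : forall i, 'M[R]_(q i))
    (X Y : 'M[R]_(p + \sum_i q i, c)) :
  (forall i, D i \in unitmx) -> arrow_mx P U D *m X = Y ->
  arrow_schur P U D *m usubmx X =
    usubmx Y - \sum_i U i *m invmx (D i) *m submxcol (dsubmx Y) i /\
  forall i, submxcol (dsubmx X) i =
            invmx (D i) *m (submxcol (dsubmx Y) i - (U i)^T *m usubmx X).
Proof.
move=> uD /arrow_mulmx [topE botE].
have subE i : submxcol (dsubmx X) i =
    invmx (D i) *m (submxcol (dsubmx Y) i - (U i)^T *m usubmx X).
  by rewrite -botE [_ + _ - _]addrAC subrr add0r mulKmx.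
split=> //; rewrite -topE mulmxBl mulmx_suml -addrA -sumrB -sumrN.
congr (_ + _); apply: eq_bigr => i _.
by rewrite subE mulmxBr mulmxBr !mulmxA [RHS]addrAC subrr sub0r.
Qed.

(** Adding to the border rows a combination of the block rows clears the upper
    right corner and leaves a block triangular matrix. *)
Lemma det_arrow (R : comUnitRingType) (k p : nat) (q : 'I_k -> nat)
    (P : 'M[R]_p) (U : forall i, 'M[R]_(p, q i)) (D : forall i, 'M[R]_(q i)) :
  (forall i, D i \in unitmx) ->
  \det (arrow_mx P U D) = \det (arrow_schur P U D) * \prod_i \det (D i).
Proof.
move=> uD.
have -> : arrow_mx P U D =
    block_mx 1%:M (\mxrow_i (U i *m invmx (D i))) 0 1%:M *m
    block_mx (arrow_schur P U D) 0 (\mxrow_i U i)^T (\mxdiag_i D i).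
  rewrite mulmx_block !(mul0mx, mul1mx, mulmx0, add0r) mul_mxrow_mxdiag.
  congr (block_mx _ _ _ _); first by rewrite tr_mxrow mul_mxrow_mxcol subrK.
  by apply: eq_mxrow => i; rewrite mulmxKV.
by rewrite det_mulmx det_ublock det_lblock !det1 !mul1r det_mxdiag.
Qed.

Lemma arrow_unitmx (R : comUnitRingType) (k p : nat) (q : 'I_k -> nat)
    (P : 'M[R]_p) (U : forall i, 'M[R]_(p, q i)) (D : forall i, 'M[R]_(q i)) :
  (forall i, D i \in unitmx) -> arrow_schur P U D \in unitmx ->
  arrow_mx P U D \in unitmx.
Proof.
move=> uD uS; rewrite unitmxE det_arrow // unitrM -unitmxE uS /=.
by apply: rpred_prod => i _; rewrite -unitmxE.
Qed.

(** The product of the inverse with [Y] is the solution of a linear system, so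
    that elimination evaluates it; this expands the inverse of a group inside the
    outer elimination. *)
Lemma arrow_invmx_form (R : comUnitRingType) (k p b c : nat) (q : 'I_k -> nat)
    (P : 'M[R]_p) (U : forall i, 'M[R]_(p, q i)) (D : forall i, 'M[R]_(q i))
    (u : 'M[R]_(b, p)) (w : forall i, 'M[R]_(b, q i))
    (Y : 'M[R]_(p + \sum_i q i, c)) :
  (forall i, D i \in unitmx) -> arrow_schur P U D \in unitmx ->
  row_mx u (\mxrow_i w i) *m invmx (arrow_mx P U D) *m Y =
    \sum_i w i *m invmx (D i) *m submxcol (dsubmx Y) i +
    (u - \sum_i w i *m invmx (D i) *m (U i)^T) *m invmx (arrow_schur P U D) *m
      (usubmx Y - \sum_i U i *m invmx (D i) *m submxcol (dsubmx Y) i).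
Proof.
move=> uD uS; set X := invmx (arrow_mx P U D) *m Y.
have [] : _ /\ _ := @arrow_solve _ _ _ _ _ P U D X Y uD _.
  by rewrite mulKVmx // arrow_unitmx.
move=> topE botE; rewrite -topE -!mulmxA -/X mulKmx //.
rewrite -[X in LHS]vsubmxK mul_row_col -[dsubmx X]submxcolK mul_mxrow_mxcol.
rewrite mulmxBl mulmx_suml addrC [RHS]addrCA; rewrite addrC -sumrB.
by congr (_ + _); apply: eq_bigr => i _; rewrite botE mulmxBr mulmxBr !mulmxA.
Qed.

(** * Elimination in a three-level matrix *)

Section RowParts.
Variables (R : realType) (m p q1 q2 c : nat) (n : 'I_m -> nat).
Variable X : 'M[R]_(p + dim3 q1 q2 n, c).

(** [vec1], [vec2i] and [vec2ij] extended to several columns, so that a linear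
    system and the block columns of an inverse are covered by one statement. *)
Definition rows1 : 'M[R]_(p, c) := usubmx X.
Definition rows2 (i : 'I_m) : 'M[R]_(dim2 q1 q2 (n i), c) :=
  submxcol (dsubmx X) i.
Definition rows2i (i : 'I_m) : 'M[R]_(q1, c) := usubmx (rows2 i).
Definition rows2ij (i : 'I_m) (j : 'I_(n i)) : 'M[R]_(q2, c) :=
  submxcol (dsubmx (rows2 i)) j.

End RowParts.

Arguments rows1 {R m p q1 q2 c n}.
Arguments rows2 {R m p q1 q2 c n}.
Arguments rows2i {R m p q1 q2 c n}.
Arguments rows2ij {R m p q1 q2 c n}.

Section Elimination.
Variables (R : realType) (m p q1 q2 : nat) (n : 'I_m -> nat).
Variables (A11 : 'M[R]_p) (A12i : 'I_m -> 'M[R]_(p, q1))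
  (A12ij : forall i : 'I_m, 'I_(n i) -> 'M[R]_(p, q2))
  (A22i : 'I_m -> 'M[R]_q1)
  (A12i_j : forall i : 'I_m, 'I_(n i) -> 'M[R]_(q1, q2))
  (A22ij : forall i : 'I_m, 'I_(n i) -> 'M[R]_q2).

Arguments A12ij : clear implicits.
Arguments A12i_j : clear implicits.
Arguments A22ij : clear implicits.

Let A := three_level_mx A11 A12i A12ij A22i A12i_j A22ij.

Definition group_row (i : 'I_m) : 'M[R]_(p, dim2 q1 q2 (n i)) :=
  row_mx (A12i i) (\mxrow_j A12ij i j).

Definition group_mx (i : 'I_m) : 'M[R]_(dim2 q1 q2 (n i)) :=
  arrow_mx (A22i i) (A12i_j i) (A22ij i).

(** What remains of the rows and columns of level two once the innermost blocks
    are eliminated: [red12], [red22] and [red_rhs] are H_{12,i}, H_{22,i} and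
    h_{2,i}. *)
Definition red12 (i : 'I_m) : 'M[R]_(p, q1) :=
  A12i i - \sum_(j < n i) A12ij i j *m invmx (A22ij i j) *m (A12i_j i j)^T.

Definition red22 (i : 'I_m) : 'M[R]_q1 :=
  arrow_schur (A22i i) (A12i_j i) (A22ij i).

Definition red_rhs c (Y : 'M[R]_(p + dim3 q1 q2 n, c)) (i : 'I_m) :
    'M[R]_(q1, c) :=
  rows2i Y i - \sum_(j < n i) A12i_j i j *m invmx (A22ij i j) *m rows2ij Y i j.

Lemma three_level_arrow : A = arrow_mx A11 group_row group_mx.
Proof.
congr (block_mx _ _ _ _).
by apply: eq_mxdiag => i; rewrite /group_mx /arrow_mx tr_mxrow.
Qed.

Hypothesis A22ij_sym : forall (i : 'I_m) (j : 'I_(n i)), (A22ij i j)^T = A22ij i j.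
Hypothesis A22ij_unit : forall (i : 'I_m) (j : 'I_(n i)), A22ij i j \in unitmx.
Hypothesis red22_unit : forall i : 'I_m, red22 i \in unitmx.

Lemma group_mx_unit i : group_mx i \in unitmx.
Proof. exact: (arrow_unitmx (@A22ij_unit i) (red22_unit i)). Qed.

(** [red12] comes from eliminating in the columns, its transpose from eliminating
    in the rows; the two agree because the innermost blocks are symmetric. *)
Lemma tr_red12 i :
  (red12 i)^T =
  (A12i i)^T - \sum_(j < n i) A12i_j i j *m invmx (A22ij i j) *m (A12ij i j)^T.
Proof.
rewrite linearB linear_sum /=; congr (_ - _); apply: eq_bigr => j _.
by rewrite trmx_mul trmx_mul trmxK trmx_inv A22ij_sym mulmxA.
Qed.

Lemma group_invmx_form c i (Y : 'M[R]_(dim2 q1 q2 (n i), c)) :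
  group_row i *m invmx (group_mx i) *m Y =
    \sum_(j < n i) A12ij i j *m invmx (A22ij i j) *m submxcol (dsubmx Y) j +
    red12 i *m invmx (red22 i) *m
      (usubmx Y - \sum_(j < n i) A12i_j i j *m invmx (A22ij i j)
                                   *m submxcol (dsubmx Y) j).
Proof. exact: (arrow_invmx_form _ _ _ (@A22ij_unit i) (red22_unit i)). Qed.

Lemma three_level_schur :
  arrow_schur A11 group_row group_mx =
  A11 - \sum_(i < m) \sum_(j < n i)
          A12ij i j *m invmx (A22ij i j) *m (A12ij i j)^T
      - \sum_(i < m) red12 i *m invmx (red22 i) *m (red12 i)^T.
Proof.
rewrite -addrA -opprD -big_split /=; congr (_ - _); apply: eq_bigr => i _.
rewrite group_invmx_form tr_red12 tr_row_mx tr_mxrow col_mxKu col_mxKd.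
congr (_ + _); first by apply: eq_bigr => j _; rewrite mxcolK.
by congr (_ *m (_ - _)); apply: eq_bigr => j _; rewrite mxcolK.
Qed.

(** Once the outer border unknowns are moved to the right-hand side, each group is
    an arrowhead system of its own; elimination in it gives the unknowns of levels
    two and three. *)
Lemma three_level_solve c (X Y : 'M[R]_(p + dim3 q1 q2 n, c)) : A *m X = Y ->
  [/\ arrow_schur A11 group_row group_mx *m rows1 X =
        rows1 Y - \sum_(i < m) red12 i *m invmx (red22 i) *m red_rhs Y i
                - \sum_(i < m) \sum_(j < n i)
                    A12ij i j *m invmx (A22ij i j) *m rows2ij Y i j,
      forall i, rows2i X i =
        invmx (red22 i) *m (red_rhs Y i - (red12 i)^T *m rows1 X)
    & forall i j, rows2ij X i j =
        invmx (A22ij i j) *m (rows2ij Y i j - (A12ij i j)^T *m rows1 X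
                                - (A12i_j i j)^T *m rows2i X i)].
Proof.
rewrite three_level_arrow => AX.
have [top _] := arrow_solve group_mx_unit AX.
have [_ bot] := arrow_mulmx AX.
have groupE i : group_mx i *m rows2 X i = rows2 Y i - (group_row i)^T *m rows1 X.
  by rewrite -[rows2 Y i]bot addrAC subrr add0r.
have rhs_u i : usubmx (rows2 Y i - (group_row i)^T *m rows1 X) =
    rows2i Y i - (A12i i)^T *m rows1 X.
  by rewrite linearB /= tr_row_mx mul_col_mx col_mxKu.
have rhs_d i j : submxcol (dsubmx (rows2 Y i - (group_row i)^T *m rows1 X)) j =
    rows2ij Y i j - (A12ij i j)^T *m rows1 X.
  rewrite linearB /= tr_row_mx mul_col_mx col_mxKd submxcolB.
  by rewrite -submxcol_mul tr_mxrow mxcolK.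
split=> [|i|i j].
- rewrite [LHS]top -addrA -opprD -big_split /=; congr (_ - _).
  by apply: eq_bigr => i _; rewrite group_invmx_form addrC.
- have [S_eq _] := arrow_solve (@A22ij_unit i) (groupE i).
  apply: (canRL (mulKmx (red22_unit i))); rewrite [LHS]S_eq rhs_u tr_red12.
  rewrite mulmxBl mulmx_suml /red_rhs.
  rewrite [X in _ - X = _](eq_bigr _ (fun j _ => congr1 _ (rhs_d i j))).
  under [X in _ - X = _]eq_bigr do rewrite mulmxBr mulmxA.
  rewrite sumrB !opprB addrACA [RHS]addrACA; congr (_ + _); exact: addrC.
- have [_ subE] := arrow_solve (@A22ij_unit i) (groupE i).
  by rewrite [LHS]subE rhs_d.
Qed.

Lemma det_three_level :
  \det A = \det (arrow_schur A11 group_row group_mx) *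
           \prod_(i < m) (\det (red22 i) * \prod_(j < n i) \det (A22ij i j)).
Proof.
rewrite three_level_arrow det_arrow; last exact: group_mx_unit.
by congr (_ * _); apply: eq_bigr => i _; rewrite det_arrow.
Qed.

End Elimination.

(** * Block columns of a symmetric matrix *)

Section Columns.
Variables (R : realType) (m p q1 q2 : nat) (n : 'I_m -> nat).
Implicit Types M : 'M[R]_(p + dim3 q1 q2 n).

Definition cols1 M := lsubmx M.
Definition cols2i M (i : 'I_m) := lsubmx (submxrow (rsubmx M) i).
Definition cols2ij M (i : 'I_m) (j : 'I_(n i)) :=
  submxrow (rsubmx (submxrow (rsubmx M) i)) j.

Lemma mulmx_cols1 M N : M *m cols1 N = cols1 (M *m N).
Proof. exact: mulmx_lsub. Qed.

Lemma mulmx_cols2i M N i : M *m cols2i N i = cols2i (M *m N) i.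
Proof. by rewrite mulmx_lsub mul_submxrow mulmx_rsub. Qed.

Lemma mulmx_cols2ij M N i (j : 'I_(n i)) : M *m cols2ij N j = cols2ij (M *m N) j.
Proof. by rewrite mul_submxrow mulmx_rsub mul_submxrow mulmx_rsub. Qed.

(** Only the blocks on and above the diagonal have names; those below it are
    their transposes by symmetry. *)
Lemma rows_cols M : M^T = M ->
  [/\ rows1 (cols1 M) = blk11 M, forall i, rows2i (cols1 M) i = (blk12i M i)^T
    & forall i j, rows2ij (cols1 M) i j = (blk12ij M i j)^T] /\
  (forall i, [/\ rows1 (cols2i M i) = blk12i M i,
      rows2i (cols2i M i) i = blk22i M i
    & forall j, rows2ij (cols2i M i) i j = (blk12i_j M i j)^T]) /\
  (forall i j, [/\ rows1 (cols2ij M j) = blk12ij M i j,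
      rows2i (cols2ij M j) i = blk12i_j M i j
    & rows2ij (cols2ij M j) i j = blk22ij M i j]).
Proof.
move=> symM; have eM s t : M s t = M t s by rewrite -{1}symM mxE.
split; last split.
- by split=> [|i|i j]; apply/matrixP => s t; rewrite !mxE // eM.
- by move=> i; split=> [||j]; apply/matrixP => s t; rewrite !mxE // eM.
- by move=> i j; split; apply/matrixP => s t; rewrite !mxE.
Qed.

(** Seeing the identity as a three-level matrix makes [three_level_mxK] compute
    all its blocks. *)
Lemma three_level_mx1 :
  1%:M = three_level_mx 1%:M (fun=> 0) (fun _ _ => 0) (fun=> 1%:M)
           (fun _ _ => 0) (fun _ _ => 1%:M) :> 'M[R]_(p + dim3 q1 q2 n).
Proof.
rewrite /three_level_mx scalar_mx_block.
have -> : \mxrow_(i < m) row_mx 0 (\mxrow_(j < n i) 0) = 0 :> 'M[R]_(p, dim3 q1 q2 n).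
  by rewrite -[RHS]mxrow0; apply: eq_mxrow => i; rewrite mxrow0 row_mx0.
rewrite trmx0; congr (block_mx _ _ _ _); rewrite -mxdiagZ; apply: eq_mxdiag => i.
rewrite trmx0 mxrow0 mxcol0 scalar_mx_block; congr (block_mx _ _ _ _).
by rewrite -mxdiagZ.
Qed.

Lemma rows_cols_id (I := 1%:M : 'M[R]_(p + dim3 q1 q2 n)) :
  [/\ rows1 (cols1 I) = 1%:M, forall i, rows2i (cols1 I) i = 0
    & forall i j, rows2ij (cols1 I) i j = 0] /\
  (forall i, [/\ rows1 (cols2i I i) = 0, rows2i (cols2i I i) i = 1%:M
    & forall j, rows2ij (cols2i I i) i j = 0]) /\
  (forall i j, [/\ rows1 (cols2ij I j) = 0, rows2i (cols2ij I j) i = 0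
    & rows2ij (cols2ij I j) i j = 1%:M]).
Proof.
have [[r1 r2 r3] [s t]] := rows_cols (trmx1 R (p + dim3 q1 q2 n)).
have [d11 d2 d3] := three_level_mxK (1%:M : 'M[R]_p) (fun=> 0) (fun i (j : 'I_(n i)) => 0)
  (fun=> 1%:M : 'M[R]_q1) (fun i j => 0) (fun i j => 1%:M : 'M[R]_q2).
rewrite -three_level_mx1 -/I in d11 d2 d3.
split; last split.
- split=> [|i|i j]; rewrite ?r1 ?r2 ?r3 //; first by rewrite (d2 i).1 trmx0.
  by have [-> _ _] := d3 i j; rewrite trmx0.
- move=> i; have [-> -> r] := s i; have [-> ->] := d2 i; split=> // j.
  by rewrite r; have [_ -> _] := d3 i j; rewrite trmx0.
- by move=> i j; have [-> -> ->] := t i j; have [-> -> ->] := d3 i j.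
Qed.

End Columns.

Unset Implicit Arguments.
Set Strict Implicit.

(** * Inverse, determinant and linear system *)

Theorem theorem3 (R : realType) (m p q1 q2 : nat) (n : 'I_m -> nat)
  (m_gt0 : (0 < m)%N) (p_gt0 : (0 < p)%N)
  (q1_gt0 : (0 < q1)%N) (q2_gt0 : (0 < q2)%N)
  (n_gt0 : forall i : 'I_m, (0 < n i)%N)
  (A11 : 'M[R]_p)
  (A12i : 'I_m -> 'M[R]_(p, q1))
  (A12ij : forall i : 'I_m, 'I_(n i) -> 'M[R]_(p, q2))
  (A22i : 'I_m -> 'M[R]_q1)
  (A12i_j : forall i : 'I_m, 'I_(n i) -> 'M[R]_(q1, q2))
  (A22ij : forall i : 'I_m, 'I_(n i) -> 'M[R]_q2)
  (a1 : 'cV[R]_p)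
  (a2i : 'I_m -> 'cV[R]_q1)
  (a2ij : forall i : 'I_m, 'I_(n i) -> 'cV[R]_q2) :
  let A := three_level_mx A11 A12i A12ij A22i A12i_j A22ij in
  let a := three_level_cV a1 a2i a2ij in
  let h2 (i : 'I_m) : 'cV[R]_q1 :=
    a2i i - \sum_(j < n i) A12i_j i j *m invmx (A22ij i j) *m a2ij i j in
  let H12 (i : 'I_m) : 'M[R]_(p, q1) :=
    A12i i - \sum_(j < n i) A12ij i j *m invmx (A22ij i j) *m (A12i_j i j)^T in
  let H22 (i : 'I_m) : 'M[R]_q1 :=
    A22i i - \sum_(j < n i) A12i_j i j *m invmx (A22ij i j) *m (A12i_j i j)^T in
  let Schur : 'M[R]_p :=
    A11 - \sum_(i < m) \sum_(j < n i)
            A12ij i j *m invmx (A22ij i j) *m (A12ij i j)^T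
        - \sum_(i < m) H12 i *m invmx (H22 i) *m (H12 i)^T in
  let B := invmx A in
  let B11 := blk11 B in
  let B12i := blk12i B in
  let B12ij := blk12ij B in
  let B22i := blk22i B in
  let B12i_j := blk12i_j B in
  let B22ij := blk22ij B in
  A^T = A ->
  A \in unitmx ->
  (forall (i : 'I_m) (j : 'I_(n i)), A22ij i j \in unitmx) ->
  (forall i : 'I_m, H22 i \in unitmx) ->
  (* inverse sub-blocks *)
  [/\ Schur \in unitmx /\ B11 = invmx Schur,
      forall i : 'I_m,
        B12i i = - (invmx (H22 i) *m (H12 i)^T *m B11)^T /\
        B22i i = invmx (H22 i) *m (1%:M - (H12 i)^T *m B12i i)
    & forall (i : 'I_m) (j : 'I_(n i)),
      [/\ B12ij i j =
            - (invmx (A22ij i j) *m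
                 ((A12ij i j)^T *m B11 + (A12i_j i j)^T *m (B12i i)^T))^T,
          B12i_j i j =
            - (invmx (A22ij i j) *m
                 ((A12ij i j)^T *m B12i i + (A12i_j i j)^T *m B22i i))^T
        & B22ij i j =
            invmx (A22ij i j) *m
              (1%:M - (A12ij i j)^T *m B12ij i j
                    - (A12i_j i j)^T *m B12i_j i j)]] /\
  (* determinant *)
  \det A =
    \det (invmx B11) *
    \prod_(i < m)
      (\det (A22i i - \sum_(j < n i)
               A12i_j i j *m invmx (A22ij i j) *m (A12i_j i j)^T) *
       \prod_(j < n i) \det (A22ij i j)) /\
  (* linear system *)
  (exists! x : 'cV[R]_(p + dim3 q1 q2 n), A *m x = a) /\
  (forall x : 'cV[R]_(p + dim3 q1 q2 n), A *m x = a ->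
    [/\ vec1 x =
          B11 *m (a1 - \sum_(i < m) H12 i *m invmx (H22 i) *m h2 i
                     - \sum_(i < m) \sum_(j < n i)
                         A12ij i j *m invmx (A22ij i j) *m a2ij i j),
        forall i : 'I_m,
          vec2i x i = invmx (H22 i) *m (h2 i - (H12 i)^T *m vec1 x)
      & forall (i : 'I_m) (j : 'I_(n i)),
          vec2ij x i j =
            invmx (A22ij i j) *m
              (a2ij i j - (A12ij i j)^T *m vec1 x
                        - (A12i_j i j)^T *m vec2i x i)]).
Proof.
move=> A a h2 H12 H22 Schur B B11 B12i B12ij B22i B12i_j B22ij symA uA uE uH.
have symE i j : (A22ij i j)^T = A22ij i j.
  have [_ _ /(_ i j)[_ _ <-]] := three_level_mxK A11 A12i A12ij A22i A12i_j A22ij.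
  by rewrite tr_submxblock trmx_drsub tr_submxblock trmx_drsub [_^T]symA.
have SchurE : arrow_schur A11 (group_row A12i A12ij)
    (group_mx A22i A12i_j A22ij) = Schur.
  exact: three_level_schur.
have solve c := @three_level_solve _ _ _ _ _ _ A11 A12i A12ij A22i A12i_j A22ij
  symE uE uH c.
rewrite SchurE in solve.
have symB : B^T = B by rewrite trmx_inv symA.
have AB : A *m B = 1%:M by rewrite mulmxV.
have [[b1 b2 b3] [b4 b5]] := rows_cols symB.
have [[i1 i2 i3] [i4 i5]] := @rows_cols_id R m p q1 q2 n.
have [] := solve _ (cols1 B) _ (mulmx_cols1 _ _).
rewrite AB b1 i1 => col1_top col1_i col1_ij.
(* The border rows of the first block column: the right-hand side there is the
   identity in the border and zero below, so all reductions vanish. *)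
have SB : Schur *m B11 = 1%:M.
  rewrite col1_top !big1 ?subr0 // => i _.
    by rewrite big1 // => j _; rewrite i3 mulmx0.
  by rewrite /red_rhs i2 big1 ?subr0 ?mulmx0 // => j _; rewrite i3 mulmx0.
have [uS _] := mulmx1_unit SB.
have B11E : B11 = invmx Schur by rewrite -[LHS](mulKmx uS) SB mulmx1.
split; [split=> [//|i|i j]|split; [|split]].
- have B12E : B12i i = - (invmx (H22 i) *m (H12 i)^T *m B11)^T.
    apply: oppmx_tr; rewrite -b2 col1_i /red_rhs i2 big1 => [|j _].
      by rewrite subr0 sub0r mulmxN mulmxA.
    by rewrite i3 mulmx0.
  split=> //.
  have [_ /(_ i)] := solve _ (cols2i B i) _ (mulmx_cols2i _ _ _).
  have [-> -> _] := b4 i; rewrite AB /red_rhs; have [_ -> i4j] := i4 i.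
  rewrite big1 ?subr0 // => j _; by rewrite i4j mulmx0.
- split.
  + apply: oppmx_tr; rewrite -b3 col1_ij i3 b2.
    by rewrite sub0r -opprD mulmxN.
  + have [_ _ /(_ i j)] := solve _ (cols2i B i) _ (mulmx_cols2i _ _ _).
    have [-> -> ->] := b4 i; rewrite AB; have [_ _ ->] := i4 i.
    by rewrite sub0r -opprD mulmxN => e; apply: oppmx_tr.
  + have [_ _ /(_ i j)] := solve _ (cols2ij B j) _ (mulmx_cols2ij _ _ _).
    by have [-> -> ->] := b5 i j; rewrite AB; have [_ _ ->] := i5 i j.
- by rewrite B11E invmxK -SchurE; apply: det_three_level.
- exists (B *m a); split=> [|x <-]; first by rewrite mulmxA AB mul1mx.
  by rewrite mulmxA mulVmx // mul1mx.
- move=> x /solve [x1 xi xij].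
  have [v1 v2 v3] := three_level_cVK a1 a2i a2ij.
  have h2E i : red_rhs A12i_j A22ij a i = h2 i.
    rewrite /red_rhs /h2 [rows2i _ _]v2; congr (_ - _).
    by apply: eq_bigr => j _; rewrite [rows2ij _ _ _]v3.
  split=> [|i|i j].
  + rewrite B11E; apply: (canRL (mulKmx uS)); rewrite [LHS]x1 [rows1 _]v1.
    congr (_ - _ - _); first by apply: eq_bigr => i _; rewrite h2E.
    by apply: eq_bigr => i _; apply: eq_bigr => j _; rewrite [rows2ij _ _ _]v3.
  + by rewrite [LHS]xi h2E.
  + by rewrite [LHS]xij [rows2ij _ _ _]v3.
Qed.
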